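(* Let $f:\mathbb{R}^2\to\mathbb{R}^2$ be defined by $f(\theta)=\theta$ and $f((x_1,x_2))=\left(\frac{x_1^2-x_2^2}{\sqrt{x_1^2+x_2^2}},\frac{2x_1x_2}{\sqrt{x_1^2+x_2^2}}\right)$ for $(x_1,x_2)\in\mathbb{R}^2\setminus\{\theta\}$, where $\theta$ is the origin. Then $f$ is not Mordukhovich differentiable at $\theta$. More precisely, $$\widehat{D}^*f(\theta)(y)=\emptyset\quad\text{for any } y\in\mathbb{R}^2\setminus\{\theta\}.$$
   Context: $\mathbb{R}^n$ carries the Euclidean norm $\|\cdot\|$ and inner product $\langle\cdot,\cdot\rangle$. For a continuous single-valued mapping $g:\mathbb{R}^n\to\mathbb{R}^m$, a point $x\in\mathbb{R}^n$ and $y\in\mathbb{R}^m$, the Mordukhovich derivative (coderivative) is the set $$\widehat{D}^*g(x)(y)=\left\{z\in\mathbb{R}^n:\ \limsup_{u\to x}\frac{\langle z,u-x\rangle-\langle y,g(u)-g(x)\rangle}{\|u-x\|+\|g(u)-g(x)\|}\le 0\right\}.$$ $g$ is called Mordukhovich differentiable at $x$ if $\widehat{D}^*g(x)(y)\neq\emptyset$ for every $y\in\mathbb{R}^m$. *)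

(* Defs.v *)
From HB Require Import structures.
From mathcomp Require Import all_boot all_order all_algebra.
From mathcomp Require Import all_classical all_reals all_analysis.

Set Implicit Arguments.
Unset Strict Implicit.
Unset Printing Implicit Defensive.

Import Order.TTheory GRing.Theory Num.Theory.
Import numFieldNormedType.Exports.

Local Open Scope classical_set_scope.
Local Open Scope ring_scope.

Definition dotv (R : realType) (n : nat) (u v : 'rV[R]_n) : R :=
  \sum_(i < n) u 0 i * v 0 i.

(* The library norm `|u| on 'rV[R]_n is the sup norm, so the Euclidean norm is
   defined separately; both induce the topology used by x^' below. *)
Definition enorm (R : realType) (n : nat) (u : 'rV[R]_n) : R :=
  Num.sqrt (dotv u u).

(* The upper limit is over the punctured neighborhoods of x, so that u <> x and
   the denominator is positive.  The notion is usually restricted to continuous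
   g; the formula itself does not need continuity. *)
Definition coderivative (R : realType) (n m : nat)
    (g : 'rV[R]_n -> 'rV[R]_m) (x : 'rV[R]_n) (y : 'rV[R]_m) :
    set 'rV[R]_n :=
  [set z | (limf_esup
    (fun u : 'rV[R]_n => ((dotv z (u - x) - dotv y (g u - g x)) /
               (enorm (u - x) + enorm (g u - g x)))%:E)
    x^' <= 0)%E].

Definition mordukhovich_differentiable (R : realType) (n m : nat)
    (g : 'rV[R]_n -> 'rV[R]_m) (x : 'rV[R]_n) : Prop :=
  forall y : 'rV[R]_m, coderivative g x y !=set0.

(* In complex notation, z ^+ 2 / `|z|. *)
Definition angle_doubling (R : realType) (x : 'rV[R]_2) : 'rV[R]_2 :=
  let x1 := x 0 0 in
  let x2 := x 0 1 in
  if x == 0 then 0 else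
  \row_(i < 2)
    if i == 0 then (x1 ^+ 2 - x2 ^+ 2) / Num.sqrt (x1 ^+ 2 + x2 ^+ 2)
    else (2 * x1 * x2) / Num.sqrt (x1 ^+ 2 + x2 ^+ 2).

(* Main.v *)
Require Import Defs.
From mathcomp Require Import all_boot all_order all_algebra.
From mathcomp Require Import all_classical all_reals all_analysis.
From mathcomp Require Import ring lra.
Import Order.TTheory GRing.Theory Num.Theory.
Import numFieldNormedType.Exports.
Local Open Scope classical_set_scope.
Local Open Scope ring_scope.

(** The map [f = angle_doubling] is positively homogeneous, so along a ray
    [u = t v] with [t > 0] the quotient defining the coderivative at the origin
    does not depend on [t]: it equals the quotient at [v], whose denominator is
    positive.  Hence every [z] in the coderivative at [y] satisfies
    [<z, v> <= <y, f v>] for all [v <> 0] (lemma [coderivative_homogeneous_le]).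

    Since [f] is moreover even, adding the inequalities for [v] and [-v] gives
    [0 <= <y, f v>] (lemma [coderivative_even_ge0]).  The values of [f] at
    [(1, 0)], [(0, 1)], [(1, 1)] and [(1, -1)] are positive multiples of [e1],
    [-e1], [e2] and [-e2], as [f] doubles angles, so both coordinates of [y]
    vanish. *)

Section EuclideanScaling.
Context {R : realType} {n : nat}.
Implicit Types u v w : 'rV[R]_n.

Lemma dotvZr t u v : dotv u (t *: v) = t * dotv u v.
Proof.
by rewrite /dotv mulr_sumr; apply: eq_bigr => i _; rewrite mxE mulrCA.
Qed.

Lemma dotvZl t u v : dotv (t *: u) v = t * dotv u v.
Proof. by rewrite /dotv mulr_sumr; apply: eq_bigr => i _; rewrite mxE mulrA. Qed.

Lemma dotvNr u v : dotv u (- v) = - dotv u v.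
Proof. by rewrite -scaleN1r dotvZr mulN1r. Qed.

Lemma enorm_ge0 u : 0 <= enorm u.
Proof. exact: sqrtr_ge0. Qed.

Lemma enorm_gt0 u : u != 0 -> 0 < enorm u.
Proof.
move=> u0; rewrite sqrtr_gt0 lt_def.
have sq_ge0 (i : 'I_n) : true -> 0 <= u 0 i * u 0 i.
  by rewrite -expr2 sqr_ge0.
rewrite sumr_ge0 // andbT; apply: contraNneq u0 => /eqP.
rewrite psumr_eq0 // => /allP u0; apply/eqP/rowP => i; rewrite mxE.
by have := u0 i (mem_index_enum i); rewrite mulf_eq0 orbb => /eqP.
Qed.

Lemma enormZ t u : 0 <= t -> enorm (t *: u) = t * enorm u.
Proof.
move=> t0; rewrite /enorm dotvZl dotvZr mulrA -expr2 sqrtrM ?sqr_ge0 //.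
by rewrite sqrtr_sqr ger0_norm.
Qed.

End EuclideanScaling.

(** The only property of upper limits that the argument uses: the supremum of [f]
    over each set of [F] is at least [c], so the infimum of these suprema is. *)
Lemma limf_esup_ge_frequently (R : realType) (T : choiceType) (X : filteredType T)
    (f : X -> \bar R) (F : set_system X) (c : \bar R) :
  (forall A, F A -> exists2 u, A u & (c <= f u)%E) -> (c <= limf_esup f F)%E.
Proof.
move=> freq; apply: le_ereal_inf_tmp => _ [A FA <-].
have [u Au cu] := freq A FA.
by apply: le_ereal_sup_tmp; exists (f u) => //; exists u.
Qed.

Lemma dnbhs0_meets_ray (R : realType) n (v : 'rV[R]_n) (A : set 'rV[R]_n) :
  v != 0 -> (0 : 'rV[R]_n)^' A -> exists2 t : R, 0 < t & A (t *: v).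
Proof.
move=> v0 A0.
have ray : (t *: v) @[t --> (0 : R)^'+] --> (0 : 'rV[R]_n).
  rewrite -[X in _ --> X](scale0r v).
  by apply: cvg_at_right_filter; exact: scalel_continuous.
have := ray _ A0; rewrite nbhs_simpl => rayA.
near (0 : R)^'+ => t.
have t0 : 0 < t by near: t; exact: nbhs_right_gt.
exists t => //.
have : t *: v != 0 by rewrite scaler_eq0 negb_or gt_eqF.
by near: t.
Unshelve. all: by end_near. Qed.

Section HomogeneousMap.
Context {R : realType} {n m : nat} {g : 'rV[R]_n -> 'rV[R]_m}.
Hypothesis g0 : g 0 = 0.
Hypothesis gZ : forall t v, 0 < t -> g (t *: v) = t *: g v.

(** Along the half-line through [v] the difference quotient at the origin is constant,
    so the [limsup] condition bounds the quotient at [v] itself. *)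
Lemma coderivative_homogeneous_le y z v :
  coderivative g 0 y z -> v != 0 -> dotv z v <= dotv y (g v).
Proof.
move=> zy v0.
have den_gt0 : 0 < enorm v + enorm (g v).
  by rewrite ltr_pwDl ?enorm_gt0 ?enorm_ge0.
suff : (dotv z v - dotv y (g v)) / (enorm v + enorm (g v)) <= 0.
  by rewrite pmulr_lle0 ?invr_gt0 // subr_le0.
rewrite -lee_fin; apply: le_trans zy.
apply: limf_esup_ge_frequently => A /(dnbhs0_meets_ray _ _ _ _ v0)[t t0 At].
exists (t *: v) => //; rewrite lee_fin le_eqVlt; apply/orP; left; apply/eqP.
rewrite g0 !subr0 gZ // !dotvZr !enormZ ?ltW // -mulrBr -mulrDr.
by rewrite -mulf_div divff ?gt_eqF // mul1r.
Qed.

(** The linear term [dotv z v] changes sign between [v] and [- v] while [g] does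
    not, so adding the two bounds eliminates [z]. *)
Lemma coderivative_even_ge0 y z v :
    (forall w, g (- w) = g w) ->
  coderivative g 0 y z -> v != 0 -> 0 <= dotv y (g v).
Proof.
move=> g_even zy v0.
have le_v := coderivative_homogeneous_le _ _ _ zy v0.
have := coderivative_homogeneous_le _ _ (- v) zy.
rewrite oppr_eq0 g_even dotvNr => /(_ v0) le_Nv.
lra.
Qed.

End HomogeneousMap.

Section AngleDoubling.
Context {R : realType}.
Implicit Types v y : 'rV[R]_2.

Lemma angle_doubling0 : angle_doubling (0 : 'rV[R]_2) = 0.
Proof. by rewrite /angle_doubling eqxx. Qed.

Lemma angle_doublingN v : angle_doubling (- v) = angle_doubling v.
Proof.
rewrite /angle_doubling oppr_eq0 !mxE !sqrrN; case: ifP => // _.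
apply/rowP => i; rewrite !mxE; case: ifP => // _; congr (_ / _); ring.
Qed.

Lemma angle_doublingZ (t : R) v :
  0 < t -> angle_doubling (t *: v) = t *: angle_doubling v.
Proof.
move=> t0; rewrite /angle_doubling scaler_eq0 gt_eqF //= !mxE.
case: ifP => _; first by rewrite scaler0.
rewrite !exprMn -mulrDr sqrtrM ?sqr_ge0 // sqrtr_sqr gtr0_norm //.
set s := Num.sqrt _.
have tK a : t ^+ 2 * a / (t * s) = t * (a / s).
  by rewrite expr2 -[t * t * a]mulrA -mulf_div divff ?gt_eqF // mul1r mulrA.
apply/rowP => i; rewrite !mxE; case: ifP => _; rewrite -tK; congr (_ / _); ring.
Qed.

Lemma dotv_angle_doubling y v : v != 0 ->
  dotv y (angle_doubling v) =
    (y 0 0 * (v 0 0 ^+ 2 - v 0 1 ^+ 2) + y 0 1 * (2 * v 0 0 * v 0 1)) / enorm v.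
Proof.
move=> /negbTE v0; rewrite /angle_doubling v0 /enorm /dotv !big_ord_recl !big_ord0.
rewrite !mxE /= -!expr2 !addr0.
have -> : lift ord0 ord0 = 1 :> 'I_2 by apply/val_inj.
have -> : ord0 = 0 :> 'I_2 by apply/val_inj.
ring.
Qed.

(** Clearing the denominator [enorm v] of [angle_doubling] leaves a condition that
    is linear in [y] and free of square roots, so that evaluating it at a few
    integer points decides [y]. *)
Lemma coderivative_angle_doubling_quadratic_ge0 y z (a b : R) :
    coderivative (@angle_doubling R) 0 y z ->
  0 <= y 0 0 * (a ^+ 2 - b ^+ 2) + y 0 1 * (2 * a * b).
Proof.
move=> zy; pose v : 'rV[R]_2 := \row_i if i == 0 then a else b.
have [va vb] : v 0 0 = a /\ v 0 1 = b by rewrite !mxE.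
rewrite -va -vb; have [->|v0] := eqVneq v 0.
  by rewrite !mxE; lra.
have := coderivative_even_ge0 angle_doubling0 angle_doublingZ _ _ _
  angle_doublingN zy v0.
by rewrite dotv_angle_doubling // pmulr_lge0 // invr_gt0 enorm_gt0.
Qed.

End AngleDoubling.

Theorem proposition3p2 (R : realType) :
  ~ mordukhovich_differentiable (@angle_doubling R) 0 /\
  (forall y : 'rV[R]_2, y != 0 -> coderivative (@angle_doubling R) 0 y = set0).
Proof.
have empty (y : 'rV[R]_2) :
    y != 0 -> coderivative (@angle_doubling R) 0 y = set0.
  move=> y0; rewrite -subset0 => z zy; case/eqP: y0.
  have y_ge0 a b := coderivative_angle_doubling_quadratic_ge0 _ _ a b zy.
  have [y00 y01] : y 0 0 = 0 /\ y 0 1 = 0.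
    have := (y_ge0 1 0, y_ge0 0 1, y_ge0 1 1, y_ge0 1 (- 1)).
    by move=> [[[h1 h2] h3] h4]; split; lra.
  apply/rowP => i; rewrite mxE.
  by case: i => [[|[|//]] ?]; [rewrite -[RHS]y00 | rewrite -[RHS]y01];
    congr (y _ _); apply/val_inj.
split=> // /(_ (const_mx 1)); rewrite empty; first by case.
by apply/eqP => /rowP/(_ 0); rewrite !mxE => /eqP; rewrite oner_eq0.
Qed.
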